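(* There is a polynomial $G_{n,d}(X)$ which is set-multilinear over the variable partition $X=(X_1,\ldots,X_d)$ with each $|X_i|\leq n$, such that: (i) it has a set-multilinear branching program of size $\mathrm{poly}(n,d)$; but (ii) any ordered set-multilinear branching program computing $G_{n,d}$ requires width $n^{\Omega(d)}$.
   Context: A polynomial is set-multilinear with respect to a partition $(X_1,\ldots,X_d)$ if every monomial contains exactly one variable from each $X_i$. An algebraic branching program (ABP) is a layered DAG with a start node and an end node, edges between consecutive layers labelled by linear polynomials, computing the sum over start-to-end paths of the product of edge labels; its size is its number of nodes and its width is the maximum number of nodes in a layer. A (general) set-multilinear ABP is one in which every node computes a polynomial that is set-multilinear with respect to some subcollection of $\{X_1,\ldots,X_d\}$. An ordered set-multilinear ABP is a set-multilinear ABP of depth $d$ for which there is a permutation $\sigma\in S_d$ such that every edge from layer $\ell-1$ to layer $\ell$ is labelled by a linear form in the variables of $X_{\sigma(\ell)}$. *)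

(* Defs.v *)
From HB Require Import structures.
From mathcomp Require Import all_boot all_order all_algebra all_fingroup.
From mathcomp Require Import mpoly.
Set Implicit Arguments. Unset Strict Implicit. Unset Printing Implicit Defensive.
Import GRing.Theory.
Local Open Scope ring_scope.

(* Variables: 'I_(d*n); variable v lies in the block X_i with i = v %/ n.
   Thus the partition X = (X_1,...,X_d) (0-indexed as 'I_d) has |X_i| = n. *)

Section ABP.
Variables (F : fieldType) (n d : nat).
Notation P := {mpoly F[d * n]}.

Definition set_multilinear (S : {set 'I_d}) (p : P) : Prop :=
  forall m, m \in msupp p -> forall i : 'I_d,
    (\sum_(v : 'I_(d * n) | (v %/ n)%N == i) m v)%N = (i \in S).

(* An ABP: depth D (number of edge layers), layer sizes lw 0, ..., lw D,
   lab l i j = label of the edge from node i of layer l to node j of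
   layer l+1 (0 = no edge). *)
Record ABP := mkABP {
  depth : nat;
  lw : nat -> nat;
  lab : nat -> nat -> nat -> P }.

Fixpoint nodep (A : ABP) (l : nat) : nat -> P :=
  match l with
  | 0 => fun j => (j == 0%N)%:R
  | l'.+1 => fun j => \sum_(i < lw A l') nodep A l' i * lab A l' i j
  end.

Definition abp_poly (A : ABP) : P := nodep A (depth A) 0.

Definition abp_size (A : ABP) : nat := (\sum_(l < (depth A).+1) lw A l)%N.
Definition abp_width (A : ABP) : nat := (\max_(l < (depth A).+1) lw A l)%N.

Definition is_ABP (A : ABP) : Prop :=
  [/\ lw A 0 = 1%N, lw A (depth A) = 1%N &
      forall l i j, (l < depth A)%N -> (i < lw A l)%N -> (j < lw A l.+1)%N ->
        (msize (lab A l i j) <= 2)%N].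

Definition is_smABP (A : ABP) : Prop :=
  is_ABP A /\
  forall l j, (l <= depth A)%N -> (j < lw A l)%N ->
    exists S : {set 'I_d}, set_multilinear S (nodep A l j).

Definition linear_form_in (i : 'I_d) (p : P) : Prop :=
  forall m, m \in msupp p ->
    mdeg m = 1%N /\ forall v : 'I_(d * n), (0 < m v)%N -> (v %/ n)%N = i.

Definition is_ordered_smABP (A : ABP) : Prop :=
  is_smABP A /\ depth A = d /\
  exists sigma : 'S_d, forall (l : 'I_d) i j,
    (i < lw A l)%N -> (j < lw A l.+1)%N -> linear_form_in (sigma l) (lab A l i j).

End ABP.

(* Main.v *)
Require Import Defs.
From HB Require Import structures.
From mathcomp Require Import all_boot all_order all_algebra all_fingroup.
From mathcomp Require Import mpoly zify.
Set Implicit Arguments. Unset Strict Implicit. Unset Printing Implicit Defensive.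
Import GRing.Theory.
Local Open Scope ring_scope.

(* Take h = d / 3 and let X(i, k) be the k-th variable of block i. The hard
   polynomial is
     sum_(t < h) prod_(i < h) (sum_k X(i, k) X(h + (i + t mod h), k))
                 * prod_(2h <= s < d) X(s, [s = 2h + t]),
   a sum of h matching polynomials, one for each cyclic shift t of a perfect
   matching between two groups of h blocks, each tagged by a one-hot monomial in
   the remaining blocks. Each summand has a set-multilinear branching program of
   width n, but the order in which the blocks are read depends on t. For a fixed
   order, choose a prefix containing exactly h of the 2h matched blocks. Averaging
   over t, some shift has at least h/2 pairs separated by the prefix. At 0/1 points
   whose selectors spell out this t, the polynomial becomes the identity matrix of
   size n^(number of separated pairs), and this matrix factors through the layer
   at the end of the prefix. *)

(** * Summation, rank and counting tools *)

Lemma sum_ord_mul_divmod (R : nmodType) (h n : nat) (f : nat -> nat -> R) :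
  \sum_(j < h * n) f (j %/ n)%N (j %% n)%N = \sum_(t < h) \sum_(k < n) f t k.
Proof.
have [->|n_gt0] := posnP n.
  by rewrite muln0 big_ord0 big1 // => t _; rewrite big_ord0.
rewrite -(big_mkord xpredT (fun j => f (j %/ n)%N (j %% n)%N)) big_nat_mul big_mkord.
apply: eq_bigr => t _; rewrite mulSn addnC -{1}[(t * n)%N]add0n big_addn addKn big_mkord.
apply: eq_bigr => k _.
by rewrite addnC divnMDl // modnMDl divn_small // modn_small // addn0.
Qed.

(** The identity matrix indexed by [U] factors through dimension [W], so its rank [#|U|] is at most
    [W]. *)
Lemma leq_card_of_sum_delta (F : fieldType) (U : finType) (W : nat)
    (a b : 'I_W -> U -> F) :
  (forall u w, \sum_j a j u * b j w = (u == w)%:R) -> (#|U| <= W)%N.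
Proof.
move=> ab; pose A := \matrix_(i < #|U|, j < W) a j (enum_val i).
pose B := \matrix_(j < W, i < #|U|) b j (enum_val i).
apply: (@mulmx1_min _ _ _ A B); apply/matrixP => i k.
rewrite !mxE -(inj_eq enum_val_inj) -ab.
by apply: eq_bigr => j _; rewrite !mxE.
Qed.

(** Discrete intermediate value theorem, used to find a prefix with exactly h matched blocks. *)
Lemma nat_ivt (f : nat -> nat) (h l : nat) :
    f 0 = 0 -> (forall x, (x < l)%N -> (f x.+1 <= (f x).+1)%N) -> (h <= f l)%N ->
  exists2 x, (x <= l)%N & f x = h.
Proof.
move=> f0; elim: l => [|l IHl] step hl.
  by exists 0%N => //; move: hl; rewrite f0 leqn0 => /eqP.
have [hfl|fl_lt] := leqP h (f l).
  have [x xl <-] := IHl (fun x xl => step x (ltnW xl)) hfl.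
  by exists x => //; apply: ltnW.
by exists l.+1 => //; have := step l (ltnSn l); lia.
Qed.

(** * Matchings and the pairs separated by a set of blocks *)

Definition crossing_pairs (h t : nat) (S : pred nat) : {set 'I_h} :=
  [set i : 'I_h | S i (+) S (h + (i + t) %% h)%N].

(* Averaging over the shifts t: all pairs (i, j) occur exactly once, and with
   s elements of S on the left and h - s on the right, s^2 + (h - s)^2 of them
   are separated by S. *)
Lemma exists_shift_crossing (h : nat) (S : pred nat) :
    (0 < h)%N -> (\sum_(b < h + h) S b = h)%N ->
  exists2 t, (t < h)%N &
    (h <= 2 * #|crossing_pairs h t S|)%N.
Proof.
case: h => // h _ sumS.
pose L := (\sum_(i < h.+1) S i)%N.
pose R := (\sum_(j < h.+1) S (h.+1 + j)%N)%N.
have LR : (L + R = h.+1)%N by rewrite -[RHS]sumS big_split_ord.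
pose c (t : 'I_h.+1) := #|crossing_pairs h.+1 t S|.
(* Addition in ['I_h.+1] is addition modulo [h.+1], so shifts become translations of a cyclic
   group. *)
have cE t : c t = (\sum_(i < h.+1) (S i (+) S (h.+1 + (i + t)%R)%N))%N.
  rewrite /c -sum1_card big_mkcond; apply: eq_bigr => i _.
  by rewrite inE; case: (_ (+) _).
have sumc : (\sum_t c t = L * L + R * R)%N.
  under eq_bigr => t _ do rewrite cE.
  rewrite exchange_big /=.
  (* As [L + R = h.+1], exactly R left elements and L right elements lie outside S. *)
  have cS : (\sum_(i < h.+1) ~~ S i = R)%N.
    have : (L + \sum_(i < h.+1) ~~ S i = h.+1)%N.
      rewrite -big_split /= -[RHS]card_ord -sum1_card.
      by apply: eq_bigr => i _; case: (S i).
    by move: LR; lia.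
  have cR : (\sum_(j < h.+1) ~~ S (h.+1 + j)%N = L)%N.
    have : (R + \sum_(j < h.+1) ~~ S (h.+1 + j)%N = h.+1)%N.
      rewrite -big_split /= -[RHS]card_ord -sum1_card.
      by apply: eq_bigr => i _; case: (S _).
    by move: LR; lia.
  transitivity (\sum_(i < h.+1) (S i * L + ~~ S i * R))%N.
    apply: eq_bigr => i _.
    (* For fixed i, the partner [i + t] runs over the whole right side as t varies. *)
    transitivity (\sum_(j < h.+1) (S i (+) S (h.+1 + j)%N))%N.
      by rewrite [RHS](reindex_inj (addrI i)).
    case: (S i) => /=.
      by rewrite mul0n addn0 mul1n -cR.
    by rewrite mul0n add0n mul1n.
  by rewrite big_split /= -!big_distrl /= cS.
have [/existsP[t ht]|/existsPn none] := boolP [exists t, h.+1 <= 2 * c t]%N.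
  by exists t.
(* If no shift works, the total is at most h (h + 1) / 2, whereas L^2 + R^2 >= (h + 1)^2 / 2. *)
have : (2 * \sum_t c t <= \sum_(t < h.+1) h)%N.
  rewrite big_distrr leq_sum // => t _.
  by have := none t; rewrite -ltnNge ltnS.
rewrite sumc sum_nat_const card_ord; have := (nat_Cauchy L R).1.
have : ((L + R) * (L + R) = h.+1 * h.+1)%N by rewrite LR.
by rewrite -!mulnn; nia.
Qed.

(** * Block degrees, variables and 0/1 points *)

Definition block_degree (n d i : nat) (m : 'X_{1..d * n}) : nat :=
  \sum_(v : 'I_(d * n) | (v %/ n)%N == i) m v.

(** Arbitrary degrees, rather than 0 or 1, make products unconditional: block degrees simply add.
    Set-multilinearity is recovered once no block is read twice. *)
Definition multihomogeneous (F : fieldType) (n d : nat) (e : nat -> nat)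
    (p : {mpoly F[d * n]}) : Prop :=
  forall m, m \in msupp p -> forall i, block_degree i m = e i.

Lemma multihomogeneous0 (F : fieldType) (n d : nat) (e : nat -> nat) :
  multihomogeneous e (0 : {mpoly F[d * n]}).
Proof. by move=> m; rewrite msupp0. Qed.

Lemma multihomogeneous1 (F : fieldType) (n d : nat) :
  multihomogeneous (fun=> 0%N) (1 : {mpoly F[d * n]}).
Proof.
move=> m; rewrite msupp1 inE => /eqP-> i.
by rewrite /block_degree big1 // => v _; rewrite mnm0E.
Qed.

Lemma multihomogeneous_sum (F : fieldType) (n d : nat) (e : nat -> nat)
    (I : finType) (P : pred I) (p : I -> {mpoly F[d * n]}) :
  (forall x, P x -> multihomogeneous e (p x)) ->
  multihomogeneous e (\sum_(x | P x) p x).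
Proof.
move=> hp m /msupp_sum_le /flattenP[s /mapP[x]].
by rewrite mem_filter => /andP[Px _] -> /(hp _ Px).
Qed.

Lemma multihomogeneousM (F : fieldType) (n d : nat) (e e' e'' : nat -> nat)
    (p q : {mpoly F[d * n]}) :
    (forall i, e'' i = (e i + e' i)%N) ->
  multihomogeneous e p -> multihomogeneous e' q -> multihomogeneous e'' (p * q).
Proof.
move=> ee hp hq m /msuppM_le /allpairsP[[m1 m2] [/= /hp h1 /hq h2 ->]] i.
rewrite ee -(h1 i) -(h2 i) /block_degree -big_split.
by apply: eq_bigr => v _; rewrite mnmDE.
Qed.

(* The k-th variable of block i; it is 0 when i >= d or k >= n. *)
Definition blockX (F : fieldType) (n d i k : nat) : {mpoly F[d * n]} :=
  \sum_(v : 'I_(d * n) | (v %/ n == i)%N && (v %% n == k)%N) 'X_v.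

Lemma msupp_blockX (F : fieldType) (n d i k : nat) (m : 'X_{1..d * n}) :
  m \in msupp (blockX F n d i k) ->
  exists2 v : 'I_(d * n), (v %/ n)%N = i & m = U_(v)%MM.
Proof.
move/msupp_sum_le/flattenP => [s /mapP[v]].
rewrite mem_filter => /andP[/andP[/eqP vi _] _] ->.
by rewrite msuppX inE => /eqP->; exists v.
Qed.

Lemma multihomogeneous_blockX (F : fieldType) (n d i k : nat) :
  multihomogeneous (fun b => (i == b) : nat) (blockX F n d i k).
Proof.
move=> m /msupp_blockX[v vi ->] b; rewrite /block_degree.
under eq_bigr => w _ do rewrite mnm1E.
have [<-|ib] := eqVneq i b.
  rewrite (bigD1 v) ?vi //= eqxx big1 // => w /andP[_ wv].
  by rewrite eq_sym (negPf wv).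
rewrite big1 // => w /eqP wb; case: eqP => // vw.
by move: ib; rewrite -vi -wb vw eqxx.
Qed.

Lemma msize_blockX (F : fieldType) (n d i k : nat) :
  (msize (blockX F n d i k) <= 2)%N.
Proof.
apply: (leq_trans (mmeasure_sum _ _ _ _)).
by apply/bigmax_leqP_seq => v _ _; rewrite msizeX mdeg1.
Qed.

Definition zero_one_point (F : fieldType) (n d : nat) (c : nat -> nat)
  (v : 'I_(d * n)) : F := ((v %% n)%N == c (v %/ n)%N)%:R.

Lemma meval_blockX (F : fieldType) (n d i k : nat) (c : nat -> nat) :
  (i < d)%N -> (k < n)%N ->
  (blockX F n d i k).@[zero_one_point F c] = (c i == k)%:R.
Proof.
move=> id kn; rewrite raddf_sum /=.
have vP : (i * n + k < d * n)%N by nia.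
rewrite (bigD1 (Ordinal vP)) /=; last first.
  by rewrite divnMDl ?modnMDl ?modn_small ?divn_small ?addn0 ?eqxx //; lia.
rewrite big1 ?addr0 => [|v /andP[/andP[/eqP vi /eqP vk]] /eqP []]; last first.
  by apply: val_inj; rewrite /= -vi -vk -divn_eq.
rewrite mevalXU /zero_one_point /= divnMDl ?modnMDl ?modn_small ?divn_small ?addn0 //.
  by rewrite eq_sym.
by lia.
Qed.

(** * Strands and their set-multilinearity *)

Lemma modn_addr_inj (h t x y : nat) :
  (x < h)%N -> (y < h)%N -> ((x + t) %% h = (y + t) %% h)%N -> x = y.
Proof.
by move=> xh yh /eqP; rewrite eqn_modDr !modn_small // => /eqP.
Qed.

(* Strand t reads the pairs (i, h + (i + t) mod h) for i < h, then the selector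
   blocks h + h, ..., d - 1, whose prescribed values are the one-hot code of t. *)
Definition strand_block (h t l : nat) : nat :=
  if (l < h + h)%N then if odd l then (h + (l./2 + t) %% h)%N else l./2 else l.

(** The state remembers an index: an even step leaves state 0 for state k' while reading variable
    k', and the odd step reads variable k of the partner and returns to 0. Selectors are read in
    state 0; the boolean [l == h + h + t] serves as variable index 0 or 1. *)
Definition strand_label (F : fieldType) (n d h t l k k' : nat) : {mpoly F[d * n]} :=
  if (l < h + h)%N then
    if odd l then if k' == 0 then blockX F n d (strand_block h t l) k else 0
    else if k == 0 then blockX F n d (strand_block h t l) k' else 0
  else if (k == 0) && (k' == 0) then
    blockX F n d (strand_block h t l) (l == h + h + t)%N
  else 0.

Fixpoint strand (F : fieldType) (n d h t l : nat) : nat -> {mpoly F[d * n]} :=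
  match l with
  | 0 => fun k => (k == 0%N)%:R
  | l'.+1 => fun k => \sum_(i < n) strand F n d h t l' i * strand_label F n d h t l' i k
  end.

Lemma strand_label_cases (F : fieldType) (n d h t l k k' : nat) :
  strand_label F n d h t l k k' = 0 \/
  exists x, strand_label F n d h t l k k' = blockX F n d (strand_block h t l) x.
Proof.
rewrite /strand_label; case: ifP => _; first case: ifP => _;
  case: ifP => _; by [left|right; eexists].
Qed.

Lemma msize_strand_label (F : fieldType) (n d h t l k k' : nat) :
  (msize (strand_label F n d h t l k k') <= 2)%N.
Proof.
have [->|[x ->]] := strand_label_cases F n d h t l k k'; last exact: msize_blockX.
by rewrite mmeasure0.
Qed.

Lemma multihomogeneous_strand (F : fieldType) (n d h t l k : nat) :
  multihomogeneous (fun b => count_mem b (map (strand_block h t) (iota 0 l)))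
    (strand F n d h t l k).
Proof.
elim: l k => [|l IHl] k.
  by rewrite /=; case: (k == 0); [apply: multihomogeneous1|apply: multihomogeneous0].
apply: multihomogeneous_sum => i _.
apply: (multihomogeneousM _ (IHl i) (e' := fun b => (strand_block h t l == b) : nat)).
  by move=> b; rewrite -addn1 iotaD map_cat count_cat /= addn0.
have [->|[x ->]] := strand_label_cases F n d h t l i k.
  exact: multihomogeneous0.
exact: multihomogeneous_blockX.
Qed.

(** Even steps, odd steps and selectors land in three disjoint ranges, and the cyclic shift is
    injective on the second. Hence no block is read twice. *)
Lemma strand_block_inj (h t : nat) : injective (strand_block h t).
Proof.
move=> x y; rewrite /strand_block.
have [->|h_gt0] := posnP h; first by [].
have := ltn_pmod (x./2 + t) h_gt0; have := ltn_pmod (y./2 + t) h_gt0.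
have := @modn_addr_inj h t x./2 y./2.
have := odd_double_half x; have := odd_double_half y.
case: (odd x); case: (odd y); case: ifP; case: ifP => xh yh; rewrite -!addnn; lia.
Qed.

Lemma strand_block_lt (h t d l : nat) :
  (h + h <= d)%N -> (l < d)%N -> (strand_block h t l < d)%N.
Proof.
rewrite /strand_block => hd ld; have [->//|h_gt0] := posnP h.
have := ltn_pmod (l./2 + t) h_gt0; case: ifP => lh; last by lia.
by have := odd_double_half l; case: (odd l); rewrite -addnn; lia.
Qed.

Lemma set_multilinear_of_multihomogeneous (F : fieldType) (n d : nat) (s : seq nat)
    (p : {mpoly F[d * n]}) :
  uniq s -> multihomogeneous (fun b => count_mem b s) p ->
  set_multilinear [set i : 'I_d | val i \in s] p.
Proof. by move=> us hp m /hp mp i; rewrite inE -count_uniq_mem // -mp. Qed.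

Lemma set_multilinear_strand (F : fieldType) (n d h t l k : nat) :
  set_multilinear [set i : 'I_d | val i \in map (strand_block h t) (iota 0 l)]
    (strand F n d h t l k).
Proof.
apply: set_multilinear_of_multihomogeneous (@multihomogeneous_strand _ _ _ _ _ _ _).
by rewrite map_inj_uniq ?iota_uniq //; apply: strand_block_inj.
Qed.

Lemma set_multilinear_sum (F : fieldType) (n d : nat) (S : {set 'I_d})
    (I : finType) (p : I -> {mpoly F[d * n]}) :
  (forall x, set_multilinear S (p x)) -> set_multilinear S (\sum_x p x).
Proof.
move=> hp m /msupp_sum_le /flattenP[s /mapP[x _ ->]]; exact: hp.
Qed.

Definition strand_sum (F : fieldType) (n d h : nat) : {mpoly F[d * n]} :=
  \sum_(t < h) strand F n d h t d 0.

(** Every strand reads d distinct blocks among d, hence all of them. *)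
Lemma set_multilinear_strand_sum (F : fieldType) (n d h : nat) :
  (h + h <= d)%N -> set_multilinear [set: 'I_d] (strand_sum F n d h).
Proof.
move=> hd; apply: set_multilinear_sum => t.
suff -> : [set: 'I_d] = [set i : 'I_d | val i \in map (strand_block h t) (iota 0 d)].
  exact: set_multilinear_strand.
apply/setP => i; rewrite !inE; symmetry.
have us : uniq (map (strand_block h t) (iota 0 d)).
  by rewrite map_inj_uniq ?iota_uniq //; apply: strand_block_inj.
have sub : {subset map (strand_block h t) (iota 0 d) <= iota 0 d}.
  move=> b /mapP[l]; rewrite !mem_iota /= add0n => ld ->.
  exact: strand_block_lt.
have [|_ ->] := uniq_min_size us sub; first by rewrite size_map.
by rewrite mem_iota /= add0n ltn_ord.
Qed.

(** * The set-multilinear branching program *)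

(** Node [t * n + k] is state k of strand t. The first and last edge layers carry constants, to
    enter and leave every strand in state 0, so layer [l.+1] corresponds to l steps of the
    strands. *)
Definition strands_ABP (F : fieldType) (n d h : nat) : ABP F n d :=
  @mkABP F n d d.+2
    (fun l => if (l == 0) || (l == d.+2) then 1 else h * n)%N
    (fun l i j =>
       if l == 0 then (j %% n == 0)%N%:R
       else if l == d.+1 then (i %% n == 0)%N%:R
       else if (i %/ n == j %/ n)%N then
         strand_label F n d h (i %/ n) l.-1 (i %% n) (j %% n)
       else 0).

Lemma nodepS (F : fieldType) (n d : nat) (A : ABP F n d) (l j : nat) :
  nodep A l.+1 j = \sum_(i < lw A l) nodep A l i * lab A l i j.
Proof. by []. Qed.

Lemma lw_strands_ABP (F : fieldType) (n d h l : nat) :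
  (l <= d)%N -> lw (strands_ABP F n d h) l.+1 = (h * n)%N.
Proof. by move=> ld; rewrite /= eqSS ltn_eqF. Qed.

Lemma nodep_strands_ABP (F : fieldType) (n d h l j : nat) :
  (l <= d)%N -> (j < h * n)%N ->
  nodep (strands_ABP F n d h) l.+1 j = strand F n d h (j %/ n) l (j %% n).
Proof.
elim: l j => [|l IHl] j ld jhn.
  by rewrite /= big_ord1 /= mul1r.
have -> : nodep (strands_ABP F n d h) l.+2 j =
    \sum_(i < h * n) nodep (strands_ABP F n d h) l.+1 i *
      (if (i %/ n == j %/ n)%N
       then strand_label F n d h (i %/ n) l (i %% n) (j %% n) else 0).
  rewrite nodepS lw_strands_ABP ?(ltnW ld) //; apply: eq_bigr => i _.
  by congr (_ * _); rewrite /= eqSS ltn_eqF.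
pose f t k := strand F n d h t l k *
  (if t == (j %/ n)%N then strand_label F n d h t l k (j %% n) else 0).
rewrite (eq_bigr (fun i : 'I_(h * n) => f (i %/ n)%N (i %% n)%N)); last first.
  by move=> i _; rewrite IHl // ltnW.
have jh : (j %/ n < h)%N by rewrite ltn_divLR //; case: (n) jhn => //; rewrite muln0.
rewrite sum_ord_mul_divmod (bigD1 (Ordinal jh)) //= [X in _ + X]big1 ?addr0.
  by apply: eq_bigr => k _; rewrite /f eqxx.
move=> t; rewrite -val_eqE /= => /negPf tj.
by rewrite big1 // => k _; rewrite /f tj mulr0.
Qed.

Lemma nodep_strands_ABP_end (F : fieldType) (n d h j : nat) : (0 < n)%N ->
  nodep (strands_ABP F n d h) d.+2 j = strand_sum F n d h.
Proof.
move=> n_gt0.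
have -> : nodep (strands_ABP F n d h) d.+2 j =
    \sum_(i < h * n) nodep (strands_ABP F n d h) d.+1 i * (i %% n == 0)%N%:R.
  rewrite nodepS lw_strands_ABP //; apply: eq_bigr => i _.
  by congr (_ * _); rewrite /= eqxx.
pose f t k := strand F n d h t d k * (k == 0)%N%:R.
rewrite (eq_bigr (fun i : 'I_(h * n) => f (i %/ n)%N (i %% n)%N)); last first.
  by move=> i _; rewrite nodep_strands_ABP.
rewrite sum_ord_mul_divmod; apply: eq_bigr => t _.
rewrite (bigD1 (Ordinal n_gt0)) //= big1 ?addr0 /f ?mulr1 //.
by move=> k; rewrite -val_eqE /= => /negPf->; rewrite mulr0.
Qed.

Lemma is_smABP_strands_ABP (F : fieldType) (n d h : nat) :
  (0 < n)%N -> (h + h <= d)%N -> is_smABP (strands_ABP F n d h).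
Proof.
move=> n_gt0 hd; split.
  split=> [//||l i j _ _ _]; first by rewrite /= eqxx.
  have nat1 (b : bool) : (msize (b%:R : {mpoly F[d * n]}) <= 2)%N.
    by case: b; rewrite ?msize1 ?mmeasure0.
  rewrite /=; case: ifP => _; first exact: nat1.
  case: ifP => _; first exact: nat1.
  case: ifP => _; first exact: msize_strand_label.
  by rewrite mmeasure0.
move=> [|l] j ld jl.
  exists set0 => m; rewrite /=; case: (j == 0); last by rewrite msupp0.
  by rewrite msupp1 inE => /eqP-> i; rewrite in_set0 big1 // => v _; rewrite mnm0E.
have [ld'|dl] := leqP l d.
  move: jl; rewrite lw_strands_ABP // => jl.
  by eexists; rewrite nodep_strands_ABP //; apply: set_multilinear_strand.
have -> : l = d.+1 by move: ld dl => /=; lia.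
exists setT; rewrite nodep_strands_ABP_end //; exact: set_multilinear_strand_sum.
Qed.

Lemma abp_size_strands_ABP (F : fieldType) (n d h : nat) :
  (0 < n)%N -> (0 < d)%N -> (h <= d)%N ->
  (abp_size (strands_ABP F n d h) <= 3 * (n + d) ^ 3)%N.
Proof.
move=> n_gt0 d_gt0 hd.
(* There are d + 3 layers, each with at most h n + 1 nodes. *)
apply: (@leq_trans (\sum_(l < d.+3) (h * n + 1))%N).
  by apply: leq_sum => l _ /=; case: ifP => _; lia.
by rewrite sum_nat_const card_ord !expnS expn0; nia.
Qed.

(** * Closed form and values of a strand *)

(** After the odd step, state x holds the earlier product times X(i, x); the next step multiplies by
    the partner's variable x and sums over x. *)
Lemma strand_double (F : fieldType) (n d h t i k : nat) :
  (0 < n)%N -> (i <= h)%N ->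
  strand F n d h t i.*2 k = if k == 0 then \prod_(j < i) \sum_(x < n)
     blockX F n d j x * blockX F n d (h + (j + t) %% h) x else 0.
Proof.
move=> n_gt0; elim: i k => [|i IHi] k ih.
  by rewrite big_ord0 /=; case: (k == 0).
have odd_step x : strand F n d h t i.*2.+1 x = (\prod_(j < i) \sum_(x < n)
     blockX F n d j x * blockX F n d (h + (j + t) %% h) x) * blockX F n d i x.
  rewrite [LHS]/= (bigD1 (Ordinal n_gt0)) //= big1 ?addr0 => [|y]; last first.
    by rewrite -val_eqE /= => /negPf y0; rewrite IHi ?y0 ?mul0r // ltnW.
  rewrite IHi ?(ltnW ih) //= /strand_label /strand_block odd_double doubleK.
  by rewrite (_ : i.*2 < h + h)%N //; lia.
rewrite doubleS [LHS]/=.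
under eq_bigr => x _ do rewrite -/(strand F n d h t i.*2.+1 x) odd_step.
have lab2 x : strand_label F n d h t i.*2.+1 x k =
    if k == 0 then blockX F n d (h + (i + t) %% h) x else 0.
  rewrite /strand_label /strand_block /= odd_double /= uphalf_double.
  by rewrite (_ : i.*2.+1 < h + h)%N //; lia.
under eq_bigr => x _ do rewrite lab2.
case: (k == 0); last by rewrite big1 // => x _; rewrite mulr0.
by rewrite big_ord_recr /= mulr_sumr; apply: eq_bigr => x _; rewrite mulrA.
Qed.

Lemma strand_selectors (F : fieldType) (n d h t r k : nat) : (0 < n)%N ->
  strand F n d h t (h + h + r) k = if k == 0 then (\prod_(j < h) \sum_(x < n)
     blockX F n d j x * blockX F n d (h + (j + t) %% h) x) *
     \prod_(s < r) blockX F n d (h + h + s) (s == t :> nat) else 0.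
Proof.
move=> n_gt0; elim: r k => [|r IHr] k.
  by rewrite addn0 addnn strand_double // big_ord0 mulr1.
rewrite addnS [LHS]/= (bigD1 (Ordinal n_gt0)) //= big1 ?addr0 => [|y]; last first.
  by rewrite -val_eqE /= => /negPf y0; rewrite IHr ?y0 ?mul0r.
rewrite IHr /= /strand_label /strand_block /= ltnNge leq_addr /=.
by case: (k == 0); rewrite ?mulr0 // big_ord_recr /= eqn_add2l mulrA.
Qed.

Lemma prod_natr_bool (R : comNzRingType) (I : finType) (b : pred I) :
  \prod_i (b i)%:R = [forall i, b i]%:R :> R.
Proof.
have [/forallP bT|] := boolP [forall i, b i].
  by rewrite big1 // => i _; rewrite bT.
by rewrite negb_forall => /existsP[i /negPf bi]; rewrite (bigD1 i) //= bi mul0r.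
Qed.

(** At a one-hot point each inner product tests equality of two choices. The bound [1 < n] ensures
    that selector variables 0 and 1 exist. *)
Lemma meval_strand (F : fieldType) (n d h t : nat) (c : nat -> nat) :
    (1 < n)%N -> (h + h <= d)%N -> (forall i : 'I_h, (c i < n)%N) ->
  (strand F n d h t d 0).@[zero_one_point F c] =
  ([forall i : 'I_h, c i == c (h + (i + t) %% h)%N] &&
   [forall s : 'I_(d - (h + h)), c (h + h + s)%N == (s == t :> nat)])%:R.
Proof.
move=> n_gt1 hd c_lt.
have := strand_selectors F d h t (d - (h + h)) 0 (ltnW n_gt1).
rewrite subnKC //= => ->; rewrite rmorphM !rmorph_prod /=.
rewrite -mulnb natrM -!prod_natr_bool; congr (_ * _); apply: eq_bigr => i _; last first.
  rewrite meval_blockX //; first by have := ltn_ord i; lia.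
  exact: leq_ltn_trans (leq_b1 _) n_gt1.
have ih := ltn_ord i; have := ltn_pmod (i + t) (leq_ltn_trans (leq0n i) ih) => ith.
rewrite rmorph_sum /= (bigD1 (Ordinal (c_lt i))) //= big1 => [|x]; last first.
  have xn := ltn_ord x; rewrite -val_eqE /= rmorphM /= !meval_blockX; try lia.
  by rewrite eq_sym => /negPf->; rewrite mul0r.
rewrite addr0 rmorphM /= !meval_blockX ?c_lt //; try lia.
by rewrite eqxx mul1r eq_sym.
Qed.

(** * Cutting an ordered program at a layer *)

(** Dual of [nodep]: the sum over paths of k edges from node j of layer l to node 0 of layer
    [l + k]. *)
Fixpoint path_tail (F : fieldType) (n d : nat) (A : ABP F n d) (k l : nat) :
    nat -> {mpoly F[d * n]} :=
  match k with
  | 0 => fun j => (j == 0%N)%:R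
  | k'.+1 => fun j => \sum_(i < lw A l.+1) lab A l j i * path_tail A k' l.+1 i
  end.

Lemma sum_nodep_path_tail (F : fieldType) (n d : nat) (A : ABP F n d) (k l : nat) :
  (0 < lw A (l + k))%N ->
  \sum_(j < lw A l) nodep A l j * path_tail A k l j = nodep A (l + k) 0.
Proof.
elim: k l => [|k IHk] l.
  rewrite addn0 => lw_gt0; rewrite (bigD1 (Ordinal lw_gt0)) //= mulr1.
  rewrite big1 ?addr0 // => j.
  by rewrite -val_eqE /= => /negPf->; rewrite mulr0.
rewrite -addSnnS => lw_gt0; rewrite -IHk //=.
under eq_bigr => j _ do rewrite mulr_sumr.
rewrite exchange_big /=; apply: eq_bigr => i _.
by rewrite mulr_suml; apply: eq_bigr => j _; rewrite mulrA.
Qed.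

Lemma eq_meval_linear_form (F : fieldType) (n d : nat) (i : 'I_d)
    (p : {mpoly F[d * n]}) (x y : 'I_(d * n) -> F) :
  linear_form_in i p -> (forall v : 'I_(d * n), (v %/ n)%N = i -> x v = y v) ->
  p.@[x] = p.@[y].
Proof.
move=> hp xy; rewrite !mevalE; apply: eq_big_seq => m /hp[_ mi].
congr (_ * _); apply: eq_bigr => v _.
by have [->|/mi/xy->] := posnP (m v).
Qed.

(* Evaluating at points that agree with point u u on the first l blocks read and
   with point w w on the others factors the matrix of values through layer l. *)
Lemma ordered_smABP_width (F : fieldType) (n d : nat) (A : ABP F n d)
    (sigma : 'S_d) (l : nat) (U : finType) (point : U -> U -> 'I_(d * n) -> F) :
    depth A = d -> lw A d = 1%N ->
    (forall (k : 'I_d) i j, (i < lw A k)%N -> (j < lw A k.+1)%N ->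
       linear_form_in (sigma k) (lab A k i j)) ->
    (l <= d)%N ->
    (forall u w (v : 'I_(d * n)) (k : 'I_d), (v %/ n)%N = sigma k ->
       point u w v = if (k < l)%N then point u u v else point w w v) ->
    (forall u w, (abp_poly A).@[point u w] = (u == w)%:R) ->
  (#|U| <= abp_width A)%N.
Proof.
move=> dA lwd lab_lin ld hpoint hval.
have head u w k j : (k <= l)%N -> (j < lw A k)%N ->
    (nodep A k j).@[point u w] = (nodep A k j).@[point u u].
  elim: k j => [|k IHk] j kl jk; first by rewrite /=; case: (j == 0); rewrite ?meval1 ?meval0.
  rewrite nodepS !rmorph_sum; apply: eq_bigr => i _ /=; rewrite !rmorphM /=.
  rewrite IHk ?(ltnW kl) //; congr (_ * _).
  pose k' := Ordinal (leq_trans kl ld).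
  apply: (eq_meval_linear_form (lab_lin k' _ _ (ltn_ord i) jk)) => v vk.
  by rewrite (hpoint _ _ _ _ vk) kl.
have tail u w r k j : (l <= k)%N -> (k + r <= d)%N -> (j < lw A k)%N ->
    (path_tail A r k j).@[point u w] = (path_tail A r k j).@[point w w].
  elim: r k j => [|r IHr] k j lk krd jk.
    by rewrite /=; case: (j == 0); rewrite ?meval1 ?meval0.
  rewrite !rmorph_sum; apply: eq_bigr => i _ /=; rewrite !rmorphM /=.
  rewrite IHr ?addSnnS ?(leqW lk) //; congr (_ * _).
  have kd : (k < d)%N by lia.
  apply: (eq_meval_linear_form (lab_lin (Ordinal kd) _ _ jk (ltn_ord i))) => v vk.
  by rewrite (hpoint _ _ _ _ vk) ltnNge lk.
apply: (@leq_trans (lw A l)).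
  apply: (@leq_card_of_sum_delta F U _
    (fun j u => (nodep A l j).@[point u u])
    (fun j w => (path_tail A (d - l) l j).@[point w w])) => u w.
  have := @sum_nodep_path_tail F n d A (d - l) l; rewrite subnKC // lwd => /(_ isT) sumE.
  rewrite -hval /abp_poly dA -sumE.
  rewrite rmorph_sum; apply: eq_bigr => j _ /=.
  by rewrite rmorphM /= (head u w) // (tail u w) // subnKC.
have ldA : (l < (depth A).+1)%N by rewrite dA.
exact: (leq_bigmax (F := fun k : 'I_(depth A).+1 => lw A k) (Ordinal ldA)).
Qed.

(* The two blocks of a crossing pair x take the values u x (inside S) and w x
   (outside), those of the other pairs 0, and the selectors spell out t. *)
Definition crossing_choice (n h t : nat) (S : pred nat)
    (u w : {ffun {i | i \in crossing_pairs h t S} -> 'I_n}) (b : nat) : nat :=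
  ((b == h + h + t) + \sum_(x : {i | i \in crossing_pairs h t S} |
    (b == val x :> nat) || (b == h + (val x + t) %% h)) (if S b then u x else w x))%N.

Lemma crossing_choice_selector (n h t : nat) (S : pred nat)
    (u w : {ffun {i | i \in crossing_pairs h t S} -> 'I_n}) (s : nat) :
  crossing_choice u w (h + h + s)%N = (s == t).
Proof.
rewrite /crossing_choice eqn_add2l big1 ?addn0 // => x.
have /= xh := ltn_ord (val x); have := ltn_pmod (val x + t) (leq_ltn_trans (leq0n _) xh).
by rewrite /= => mx hs; exfalso; lia.
Qed.

(** The shift is injective modulo h, so b belongs to the pair of i alone and at most one summand
    survives. *)
Lemma crossing_choice_pair (n h t : nat) (S : pred nat)
    (u w : {ffun {i | i \in crossing_pairs h t S} -> 'I_n}) (i : 'I_h) (b : nat) :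
  b = i \/ b = (h + (i + t) %% h)%N ->
  crossing_choice u w b =
    if insub i is Some x then if S b then u x else w x else 0%N.
Proof.
move=> hb; have ih := ltn_ord i.
have mod_lt y : ((y + t) %% h < h)%N by rewrite ltn_pmod // (leq_ltn_trans _ ih).
have pairE (x : 'I_h) : (b == x) || (b == h + (x + t) %% h)%N = (x == i).
  have xh := ltn_ord x; have mx := mod_lt x; have mi := mod_lt i.
  have inj : ((x + t) %% h = (i + t) %% h)%N -> x = i :> nat by exact: modn_addr_inj.
  rewrite -val_eqE /=; apply/idP/eqP => [|xi]; last by rewrite xi; case: hb => ->; rewrite eqxx ?orbT.
  by case: hb => ->; lia.
rewrite /crossing_choice (_ : (b == _) = false) ?add0n; last first.
  by apply/eqP; have := mod_lt i; case: hb => ->; lia.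
under eq_bigl => x do rewrite pairE.
case: insubP => [x _ xi|iC].
  by rewrite -xi (big_pred1 x) // => y; rewrite (inj_eq val_inj).
by rewrite big1 // => x /eqP xi; move: iC; rewrite -xi (valP x).
Qed.

(** The selectors kill every strand but t. There, unseparated pairs compare 0 with 0, and a
    separated pair x compares [u x] with [w x], exactly one of its blocks being in S. *)
Lemma meval_strand_sum_crossing (F : fieldType) (n d h t : nat) (S : pred nat)
    (u w : {ffun {i | i \in crossing_pairs h t S} -> 'I_n}) :
    (1 < n)%N -> (h + h + h <= d)%N -> (t < h)%N ->
  (strand_sum F n d h).@[zero_one_point F (crossing_choice u w)] = (u == w)%:R.
Proof.
move=> n_gt1 hd th.
have lt_n (i : 'I_h) : (crossing_choice u w i < n)%N.
  rewrite (@crossing_choice_pair _ _ _ _ _ _ i); last by left.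
  by case: insub => [x|]; [case: ifP => _|apply: ltnW].
have hd2 : (h + h <= d)%N by lia.
rewrite rmorph_sum /= (bigD1 (Ordinal th)) //= big1 ?addr0 => [|t']; last first.
  rewrite -val_eqE /= meval_strand // => t't.
  (* As 3h <= d, selector number t' exists; it tells t' from t. *)
  have t'd : (t' < d - (h + h))%N by have := ltn_ord t'; lia.
  rewrite [X in _ && X](_ : _ = false) ?andbF //; apply/negbTE/forallPn.
  by exists (Ordinal t'd) => /=; rewrite crossing_choice_selector eqxx (negPf t't).
rewrite meval_strand // [X in _ && X](_ : _ = true) ?andbT; last first.
  by apply/forallP => s; rewrite crossing_choice_selector.
congr ((nat_of_bool _)%:R).
apply/forallP/eqP => [eqc|-> i]; last first.
  rewrite !(@crossing_choice_pair _ _ _ _ _ _ i); [|by right|by left].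
  by case: insub => // x; rewrite !if_same.
apply/ffunP => x; apply: val_inj; have := eqc (val x).
rewrite !(@crossing_choice_pair _ _ _ _ _ _ (val x)); [|by right|by left].
rewrite valK; have := valP x; rewrite inE.
by case: (S (val (val x))); case: (S _) => //= _ /eqP.
Qed.

(** * Balanced prefixes and the width bound *)

(** The count of matched blocks starts at 0, grows by at most one per block read, and ends at 2h. *)
Lemma exists_balanced_prefix (d h : nat) (sigma : 'S_d) : (h + h <= d)%N ->
  exists2 l, (l <= d)%N &
    (\sum_(b < h + h) [exists k : 'I_d, (k < l) && (sigma k == b :> nat)] = h)%N.
Proof.
move=> hd.
pose f l := (\sum_(b < h + h) [exists k : 'I_d, (k < l) && (sigma k == b :> nat)])%N.
apply: (@nat_ivt f) => [|l ld|].
- by apply: big1 => b _; case: existsP => // -[k].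
- have step b : ([exists k : 'I_d, (k < l.+1) && (sigma k == b :> nat)] <=
      [exists k : 'I_d, (k < l) && (sigma k == b :> nat)] +
      (sigma (Ordinal ld) == b :> nat))%N.
    case: existsP => // -[k /andP[]]; rewrite ltnS leq_eqVlt => /orP[/eqP kl|kl] /eqP kb.
      by rewrite (_ : Ordinal ld = k) ?kb ?eqxx ?addn1 //; apply: val_inj.
    by case: existsP => // -[]; exists k; rewrite kl kb eqxx.
  apply: leq_trans; first by apply: leq_sum => b _; apply: step.
  rewrite big_split /= -addn1 leq_add2l.
  have [lt|ge] := ltnP (sigma (Ordinal ld)) (h + h).
    rewrite (bigD1 (Ordinal lt)) //= eqxx big1 // => b.
    by rewrite -val_eqE /= eq_sym => /negPf->.
  by rewrite big1 // => b _; case: eqP => // sb; have := ltn_ord b; lia.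
- apply: (@leq_trans (h + h)); first exact: leq_addr.
  rewrite /f (eq_bigr (fun=> 1%N)) ?sum1_card ?card_ord // => b _.
  have bd : (b < d)%N by apply: leq_trans (ltn_ord b) hd.
  rewrite (_ : [exists k, _] = true) //; apply/existsP.
  exists ((sigma^-1)%g (Ordinal bd)).
  by rewrite ltn_ord permKV /= eqxx.
Qed.

Lemma ordered_smABP_strand_sum_width (F : fieldType) (n d h : nat) (A : ABP F n d) :
    (1 < n)%N -> (0 < h)%N -> (h + h + h <= d)%N ->
    is_ordered_smABP A -> abp_poly A = strand_sum F n d h ->
  exists2 r, (h <= 2 * r)%N & (n ^ r <= abp_width A)%N.
Proof.
move=> n_gt1 h_gt0 hd [[[_ lwA _] _] [dA [sigma lin]]] polyA.
have [|l ld bal] := @exists_balanced_prefix d h sigma; first by lia.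
pose S : pred nat := fun b => [exists k : 'I_d, (k < l)%N && (sigma k == b :> nat)].
have [t th cross] := @exists_shift_crossing h S h_gt0 bal.
exists #|crossing_pairs h t S| => //.
pose U := {ffun {i | i \in crossing_pairs h t S} -> 'I_n}.
have <- : #|{: U}| = (n ^ #|crossing_pairs h t S|)%N.
  by rewrite card_ffun card_ord card_sig; congr (_ ^ _)%N; apply: eq_card => i; rewrite inE.
have Sk (k : 'I_d) : S (sigma k) = (k < l)%N.
  apply/existsP/idP => [[k' /andP[k'l /eqP/val_inj/perm_inj <-]]//|kl].
  by exists k; rewrite kl eqxx.
apply: (@ordered_smABP_width F n d A sigma l U
  (fun u w => zero_one_point F (crossing_choice u w))) => //.
- by move: lwA; rewrite dA.
(* A block read before layer l lies in S, so its choice involves u alone; a later one involves w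
   alone. *)
- move=> u w v k vk; rewrite /zero_one_point vk.
  case: ifP => kl; congr (nat_of_bool (_ == _))%:R; congr (_ + _)%N;
    by apply: eq_bigr => x _; rewrite Sk kl.
- by move=> u w; rewrite polyA meval_strand_sum_crossing.
Qed.

(* poly(n,d) size: c * (n + d)^c;  width n^{Omega(d)}: n^d <= width^a
   (i.e. width >= n^{d/a}) for all n, d >= N. *)
Theorem theorem1p8 (F : fieldType) :
  exists c a N : nat, (0 < a)%N /\
  forall n d : nat, (0 < n)%N -> (0 < d)%N ->
  exists G : {mpoly F[d * n]},
    set_multilinear [set: 'I_d] G /\
    (exists A : ABP F n d,
        is_smABP A /\ abp_poly A = G /\ (abp_size A <= c * (n + d) ^ c)%N) /\
    ((N <= n)%N -> (N <= d)%N ->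
      forall A : ABP F n d, is_ordered_smABP A -> abp_poly A = G ->
        (n ^ d <= abp_width A ^ a)%N).
Proof.
(* For d >= 3 one has h >= 1, so d <= 3h + 2 <= 5h <= 10r, where r >= h/2 is the number of separated
   pairs; this gives the exponent 10. *)
exists 3%N, 10%N, 3%N; split=> // n d n_gt0 d_gt0.
pose h := (d %/ 3)%N.
have d_eq : d = (h * 3 + d %% 3)%N := divn_eq d 3.
have d_mod : (d %% 3 < 3)%N := ltn_pmod d (isT : 0 < 3)%N.
exists (strand_sum F n d h); split; first by apply: set_multilinear_strand_sum; lia.
split.
  exists (strands_ABP F n d h); split; first by apply: is_smABP_strands_ABP => //; lia.
  split; first exact: nodep_strands_ABP_end.
  by apply: abp_size_strands_ABP => //; lia.
move=> n_ge3 d_ge3 A ordA polyA.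
have [|||r hr rA] := ordered_smABP_strand_sum_width (h := h) _ _ _ ordA polyA; try lia.
apply: (@leq_trans ((n ^ r) ^ 10)%N); last by rewrite leq_exp2r.
by rewrite -expnM leq_exp2l //; lia.
Qed.
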